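(* Let $c>0$ and let $\tilde{x}_1,\tilde{x}_2,\tilde{x}_3,\tilde{x}_4$ be four distinct observation points in $\mathbb{R}^3$. Then the position of a point source is not uniquely determined by the time differences of arrival among these four points; that is, there exist two distinct points $s,s'\in\mathbb{R}^3\setminus\{\tilde{x}_1,\tilde{x}_2,\tilde{x}_3,\tilde{x}_4\}$ such that $$c^{-1}\big(|s-\tilde{x}_i|-|s-\tilde{x}_j|\big)=c^{-1}\big(|s'-\tilde{x}_i|-|s'-\tilde{x}_j|\big)\quad\text{for all } i,j\in\{1,2,3,4\}.$$
   Context: $|\cdot|$ is the Euclidean norm on $\mathbb{R}^3$ and $c$ is the constant wave speed. A point source at $s$ emitting at time $t$ is recorded at the observation point $\tilde{x}_i$ at the arrival time $T_i=t+c^{-1}|\tilde{x}_i-s|$; the time difference of arrival between $\tilde{x}_i$ and $\tilde{x}_j$ is $T_i-T_j=c^{-1}(|s-\tilde{x}_i|-|s-\tilde{x}_j|)$. Source positions never coincide with observation points. *)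

(* Defs.v *)
From mathcomp Require Import all_boot all_order all_algebra.
From mathcomp Require Import reals.

Set Implicit Arguments.
Unset Strict Implicit.
Unset Printing Implicit Defensive.

Import Order.TTheory GRing.Theory Num.Theory.
Local Open Scope ring_scope.

(* The library norm `|v| on row vectors is the sup norm, hence this definition. *)
Definition enorm (R : realType) (n : nat) (v : 'rV[R]_n) : R :=
  Num.sqrt (\sum_(k < n) v 0 k ^+ 2).

(* Main.v *)
Require Import Defs.
From mathcomp Require Import all_boot all_order all_algebra.
From mathcomp Require Import reals.
From mathcomp Require Import ring lra.

Set Implicit Arguments.
Unset Strict Implicit.
Unset Printing Implicit Defensive.

Import Order.TTheory GRing.Theory Num.Theory.
Local Open Scope ring_scope.

(** Only differences of distances to the four points matter, so put one of them
    at the origin and let [y i] be the other three.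

    If the [y i] are linearly dependent, the four points lie in a plane, and a
    point off the plane and its mirror image have the same distances to all of
    them ([coplanar_sources]).

    If they are independent, the ambiguous pair is sought on one line through
    the origin.  Fix [t > 0] and put [D y = sqrt (t^2 + |y|^2)], so that
    [D 0 = t].  If [b] satisfies [y . b = t - D y] at every point, then
    expanding the square gives
    [|l b - y|^2 - (l + D y)^2 = l^2 |b|^2 - (t + l)^2],
    whose right-hand side does not involve [y].  As soon as it vanishes (with
    [t + l > 0]), the distance from [l b] to each point is [l + D y], and the
    differences of these do not depend on [l] ([enorm_on_line]).  The equation
    [|l| |b| = t + l] has two such roots, [t / (|b| - 1)] and
    [- t / (|b| + 1)], exactly when [|b| > 1].

    Independence makes [b] exist for every [t].  That [|b| > 1] for small [t]
    is seen on two of the points ([enorm_gt1]): with [u], [v] their unit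
    vectors, [- b . u] and [- b . v] tend to 1 as [t] tends to 0, so that
    [- b . (u + v)] tends to 2, while [|u + v| < 2] because [u != v]. *)

(** * The Euclidean inner product *)

Definition dot (R : realType) (n : nat) (u v : 'rV[R]_n) : R :=
  \sum_(k < n) u 0 k * v 0 k.

Section Dot.
Variables (R : realType) (n : nat).
Implicit Types (u v w : 'rV[R]_n) (a : R).

Lemma dotC u v : dot u v = dot v u.
Proof. by apply: eq_bigr => k _; rewrite mulrC. Qed.

Lemma dotDl u v w : dot (u + v) w = dot u w + dot v w.
Proof. by rewrite -big_split; apply: eq_bigr => k _; rewrite mxE mulrDl. Qed.

Lemma dotZl a u v : dot (a *: u) v = a * dot u v.
Proof. by rewrite mulr_sumr; apply: eq_bigr => k _; rewrite mxE mulrA. Qed.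

Lemma dotNl u v : dot (- u) v = - dot u v.
Proof. by rewrite -scaleN1r dotZl mulN1r. Qed.

Lemma dotDr u v w : dot u (v + w) = dot u v + dot u w.
Proof. by rewrite dotC dotDl !(dotC u). Qed.

Lemma dotZr a u v : dot u (a *: v) = a * dot u v.
Proof. by rewrite dotC dotZl dotC. Qed.

Lemma dotNr u v : dot u (- v) = - dot u v.
Proof. by rewrite dotC dotNl dotC. Qed.

Lemma dot0l u : dot 0 u = 0.
Proof. by rewrite -(scale0r 0) dotZl mul0r. Qed.

Definition dot_lin := (dotDl, dotDr, dotNl, dotNr, dotZl, dotZr).

Lemma dot_ge0 u : 0 <= dot u u.
Proof. by apply: sumr_ge0 => k _; rewrite -expr2 sqr_ge0. Qed.

Lemma dot_gt0 u : u != 0 -> 0 < dot u u.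
Proof.
move=> u_neq0; rewrite lt_def dot_ge0 andbT; apply: contra u_neq0.
rewrite psumr_eq0 => [/allP u0|k _]; last by rewrite -expr2 sqr_ge0.
apply/eqP/rowP => k; rewrite mxE; apply/eqP.
by have := u0 k (mem_index_enum k); rewrite -expr2 sqrf_eq0.
Qed.

Lemma enormE u : enorm u = Num.sqrt (dot u u).
Proof. by congr Num.sqrt; apply: eq_bigr => k _; rewrite expr2. Qed.

Lemma enorm_ge0 u : 0 <= enorm u.
Proof. exact: sqrtr_ge0. Qed.

Lemma sqr_enorm u : enorm u ^+ 2 = dot u u.
Proof. by rewrite enormE sqr_sqrtr ?dot_ge0. Qed.

Lemma enorm_gt0 u : u != 0 -> 0 < enorm u.
Proof. by move=> u_neq0; rewrite enormE sqrtr_gt0 dot_gt0. Qed.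

Lemma enorm0 : enorm (0 : 'rV[R]_n) = 0.
Proof. by rewrite enormE dot0l sqrtr0. Qed.

Lemma dot_le_enorm u v : dot u v <= enorm u * enorm v.
Proof.
have [->|u_neq0] := eqVneq u 0; first by rewrite dot0l enorm0 mul0r.
have [->|v_neq0] := eqVneq v 0; first by rewrite dotC dot0l enorm0 mulr0.
have pq_gt0 : 0 < enorm u * enorm v by rewrite mulr_gt0 ?enorm_gt0.
have := dot_ge0 (enorm v *: u - enorm u *: v).
rewrite !dot_lin (dotC v u) -!sqr_enorm => sq_ge0.
rewrite -subr_ge0 -(pmulr_rge0 _ pq_gt0); lra.
Qed.

(** The alternative that separates coplanar from non-coplanar points. *)
Lemma orthogonal_or_solvable (y : 'I_n -> 'rV[R]_n) :
  (exists2 p, p != 0 & forall i, dot (y i) p = 0) \/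
  (forall d : 'I_n -> R, exists b, forall i, dot (y i) b = d i).
Proof.
pose A := \matrix_(k, i) y i 0 k.
have mulA (v : 'rV_n) i : (v *m A) 0 i = dot (y i) v.
  by rewrite mxE dotC; apply: eq_bigr => k _; rewrite mxE.
have [/det0P[p p_neq0 pA]|detA] := boolP (\det A == 0).
  by left; exists p => // i; rewrite -mulA pA mxE.
right=> d; exists ((\row_i d i) *m invmx A) => i.
by rewrite -mulA mulmxKV ?mxE // unitmxE unitfE.
Qed.

End Dot.

(** * Pairs of sources with the same distance differences *)

Section Sources.
Variables (R : realType) (n : nat).
Implicit Types (b p y : 'rV[R]_n) (l t : R).

Lemma coplanar_sources p y : p != 0 -> dot y p = 0 ->
  enorm (p - y) = enorm (- p - y) /\ 0 < enorm (p - y).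
Proof.
move=> p_neq0 yp; have := dot_gt0 p_neq0; have := dot_ge0 y => y2 p2.
rewrite !enormE !dot_lin (dotC p) yp sqrtr_gt0; split; last by lra.
by congr Num.sqrt; ring.
Qed.

(** The key identity: the right-hand side of the distance formula depends on
    [y] and [l] through separate summands, so that all [l b] satisfying the
    quadratic equation have the same distance differences. *)
Lemma enorm_on_line b y l t : 0 < t -> 0 < t + l ->
    (l * enorm b) ^+ 2 = (t + l) ^+ 2 ->
    dot y b = t - Num.sqrt (t ^+ 2 + dot y y) ->
  enorm (l *: b - y) = l + Num.sqrt (t ^+ 2 + dot y y) /\
  0 < enorm (l *: b - y).
Proof.
move=> t_gt0 tl_gt0 l_root; set D := Num.sqrt _ => yb.
have D2 : D ^+ 2 = t ^+ 2 + dot y y.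
  by rewrite sqr_sqrtr // addr_ge0 ?sqr_ge0 ?dot_ge0.
have tD : t <= D.
  rewrite -(ler_pXn2r (n := 2)) ?nnegrE ?sqrtr_ge0 ?(ltW t_gt0) //.
  by rewrite D2 lerDl dot_ge0.
have lD_gt0 : 0 < l + D by lra.
suff -> : enorm (l *: b - y) = l + D by [].
rewrite enormE -[RHS]gtr0_norm // -sqrtr_sqr; congr Num.sqrt.
rewrite !dot_lin (dotC b) yb.
move: l_root; rewrite exprMn sqr_enorm => l_root.
lra.
Qed.

(** This is what makes [- b . y / |y|] at least [1 - t / |y|] in [enorm_gt1]. *)
Lemma sqrt_sub_ge t y :
  enorm y - t <= Num.sqrt (t ^+ 2 + dot y y) - t.
Proof. by rewrite lerD2r enormE ler_wsqrtr // lerDr sqr_ge0. Qed.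

Lemma enorm_unitD_lt2 (u v : 'rV[R]_n) :
  dot u u = 1 -> dot v v = 1 -> u != v -> enorm (u + v) < 2.
Proof.
move=> u1 v1 uv; have := dot_gt0 (u := u - v); rewrite subr_eq0 => /(_ uv) sub_gt0.
rewrite -(ltr_pXn2r (n := 2)) ?nnegrE ?enorm_ge0 // sqr_enorm.
by move: sub_gt0; rewrite !dot_lin (dotC v) u1 v1; lra.
Qed.

(** If [|b| <= 1], then by Cauchy-Schwarz [- b . (u + v) <= |u + v|] for the
    unit vectors [u], [v] of [y], [z]; the left-hand side is at least
    [2 - t (1 / |y| + 1 / |z|)], which exceeds [|u + v|] for small [t]. *)
Lemma enorm_gt1 (y z : 'rV[R]_n) : y != 0 -> z != 0 ->
    (enorm y)^-1 *: y != (enorm z)^-1 *: z ->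
  exists2 t, 0 < t & forall b,
    dot y b = t - Num.sqrt (t ^+ 2 + dot y y) ->
    dot z b = t - Num.sqrt (t ^+ 2 + dot z z) -> 1 < enorm b.
Proof.
move=> /enorm_gt0 y_gt0 /enorm_gt0 z_gt0 uv.
set u := _ *: y in uv; set v := _ *: z in uv.
have unit (x : 'rV[R]_n) : 0 < enorm x ->
    dot ((enorm x)^-1 *: x) ((enorm x)^-1 *: x) = 1.
  move=> x_gt0; rewrite !dot_lin -sqr_enorm; field; exact: lt0r_neq0.
have w_lt2 := enorm_unitD_lt2 (unit _ y_gt0) (unit _ z_gt0) uv.
have w_ge0 := enorm_ge0 (u + v).
set w := enorm (u + v) in w_lt2 w_ge0.
pose k := (enorm y)^-1 + (enorm z)^-1.
have k_gt0 : 0 < k by rewrite addr_gt0 ?invr_gt0.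
(* Half of the value of t at which the lower bound 2 - t k for - b . (u + v)
   falls to |u + v|. *)
pose t := (2 - w) / 2 / k.
have t_gt0 : 0 < t by rewrite !divr_gt0 // subr_gt0.
exists t => // b yb zb.
have close (x : 'rV[R]_n) : 0 < enorm x ->
    dot x b = t - Num.sqrt (t ^+ 2 + dot x x) ->
    1 - t * (enorm x)^-1 <= dot ((enorm x)^-1 *: x) (- b).
  move=> x_gt0 xb; have := sqrt_sub_ge t x.
  rewrite dotZl dotNr xb opprB -(ler_pM2l (x := (enorm x)^-1)) ?invr_gt0 //.
  by rewrite mulrBr mulVf ?lt0r_neq0 // (mulrC t).
have := close y y_gt0 yb; have := close z z_gt0 zb; rewrite -/u -/v => zb' yb'.
have tk : t * k = (2 - w) / 2 by rewrite /t divfK // lt0r_neq0.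
have := dot_le_enorm (u + v) (- b); rewrite dotDl -/w.
have -> : enorm (- b) = enorm b by rewrite !enormE dotNl dotNr opprK.
move=> CS; rewrite ltNge; apply/negP => b_le1.
have := ler_wpM2l w_ge0 b_le1; rewrite mulr1.
move: tk; rewrite /k mulrDr; lra.
Qed.

(** The equation of [enorm_on_line] has roots of opposite signs, which puts the
    two sources on opposite sides of the origin. *)
Lemma two_roots (be t : R) : 0 < t -> 1 < be ->
  exists l l', [/\ 0 < l, l' < 0, 0 < t + l', (l * be) ^+ 2 = (t + l) ^+ 2 &
                  (l' * be) ^+ 2 = (t + l') ^+ 2].
Proof.
move=> t_gt0 be_gt1.
have m_gt0 : 0 < be - 1 by lra.
have p_gt0 : 0 < be + 1 by lra.
have m_neq0 := lt0r_neq0 m_gt0; have p_neq0 := lt0r_neq0 p_gt0.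
exists (t / (be - 1)), (- (t / (be + 1))); split.
- exact: divr_gt0.
- by rewrite oppr_lt0 divr_gt0.
- by rewrite subr_gt0 ltr_pdivrMr // ltr_pMr //; lra.
- by field.
- by field.
Qed.

End Sources.

(** * The ambiguous pair *)

(** As many points as the dimension, besides the origin, are what makes
    [orthogonal_or_solvable] a true alternative; [1 < n] provides the two
    directions compared in [enorm_gt1]. *)
Lemma ambiguous_pair (R : realType) (n : nat) (y : 'I_n -> 'rV[R]_n) :
    (1 < n)%N ->
  exists s s' : 'rV[R]_n, s != s' /\
    exists m, forall z, z = 0 \/ (exists i, z = y i) ->
      [/\ 0 < enorm (s - z), 0 < enorm (s' - z) &
          enorm (s - z) - enorm (s' - z) = m].
Proof.
move=> n_gt1; have [[p p_neq0 yp]|solve] := orthogonal_or_solvable y.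
  exists p, (- p); split.
    apply: contra p_neq0 => /eqP/rowP pN; apply/eqP/rowP => k.
    by have := pN k; rewrite !mxE; lra.
  exists 0 => z z_pt; have zp : dot z p = 0.
    by case: z_pt => [->|[i ->]]; rewrite ?dot0l ?yp.
  have [eq_d d_gt0] := coplanar_sources p_neq0 zp.
  by rewrite -eq_d subrr.
pose i := Ordinal (ltnW n_gt1); pose j := Ordinal n_gt1.
have y_neq0 h : y h != 0.
  have [b yb] := solve (fun=> 1); apply/eqP => y0.
  by have := yb h; rewrite y0 dot0l => /eqP; rewrite eq_sym oner_eq0.
have y_indep : (enorm (y i))^-1 *: y i != (enorm (y j))^-1 *: y j.
  have [b yb] := solve (fun h => (h == i)%:R); apply/eqP => uv.
  have := congr1 (fun u => dot u b) uv; rewrite !dotZl !yb mulr1 mulr0.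
  by move/eqP; rewrite invr_eq0 (negPf (lt0r_neq0 (enorm_gt0 (y_neq0 i)))).
have [t t_gt0 b_large] := enorm_gt1 (y_neq0 i) (y_neq0 j) y_indep.
have [b yb] := solve (fun h => t - Num.sqrt (t ^+ 2 + dot (y h) (y h))).
have b_gt1 := b_large b (yb i) (yb j).
have [l [l' [l_gt0 l'_lt0 tl' lb l'b]]] := two_roots t_gt0 b_gt1.
exists (l *: b), (l' *: b); split.
  rewrite -subr_eq0 -scalerBl scaler_eq0 negb_or; apply/andP; split.
    by apply: lt0r_neq0; lra.
  by apply/eqP => b0; move: b_gt1; rewrite b0 enorm0 ltr10.
exists (l - l') => z z_pt.
have zb : dot z b = t - Num.sqrt (t ^+ 2 + dot z z).
  case: z_pt => [->|[h ->]]; last exact: yb.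
  by rewrite !dot0l addr0 sqrtr_sqr gtr0_norm // subrr.
have tl : 0 < t + l by lra.
have [ds ds_gt0] := enorm_on_line t_gt0 tl lb zb.
have [ds' ds'_gt0] := enorm_on_line t_gt0 tl' l'b zb.
by split=> //; rewrite ds ds'; lra.
Qed.

Theorem theorem2p2 (R : realType) (c : R) (x : 'I_4 -> 'rV[R]_3)
    (c_gt0 : 0 < c) (x_inj : injective x) :
  exists s s' : 'rV[R]_3,
    [/\ s <> s',
        (forall i : 'I_4, s <> x i),
        (forall i : 'I_4, s' <> x i) &
        forall i j : 'I_4,
          c^-1 * (enorm (s - x i) - enorm (s - x j)) =
          c^-1 * (enorm (s' - x i) - enorm (s' - x j))].
Proof.
pose y (h : 'I_3) := x (lift ord0 h) - x ord0.
have [s [s' [ss' [m dist]]]] := ambiguous_pair y isT.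
have {}dist i : [/\ 0 < enorm (x ord0 + s - x i), 0 < enorm (x ord0 + s' - x i) &
    enorm (x ord0 + s - x i) - enorm (x ord0 + s' - x i) = m].
  have shift v : x ord0 + v - x i = v - (x i - x ord0).
    by rewrite opprB addrCA addrA.
  rewrite !shift; apply: dist.
  by case: (unliftP ord0 i) => [h|] ->; [right; exists h | left; rewrite subrr].
have off v i : 0 < enorm (v - x i) -> v <> x i.
  by move=> d_gt0 vx; move: d_gt0; rewrite vx subrr enorm0 ltxx.
exists (x ord0 + s), (x ord0 + s'); split.
- by move/addrI/eqP; rewrite (negPf ss').
- by move=> i; apply: off; case: (dist i).
- by move=> i; apply: off; case: (dist i).
move=> i j; congr (_ * _); have [_ _ di] := dist i; have [_ _ dj] := dist j.
lra.
Qed.
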